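(* Let $\psi(y_1,\dots,y_n,x)$ be a quantifier-free formula in the (continuous-logic) language of bi-invariant metric groups and let $\varphi$ be the sentence $\inf_x\sup_{y_1,\dots,y_n}\psi(y_1,\dots,y_n,x)$. Then the sequence $(\varphi^{S_n})_{n\in\mathbb{N}}$ converges.
   Context: $S_n$ is the symmetric group on $\{1,\dots,n\}$, regarded as a bi-invariant metric group (metric structure with multiplication, inverse, identity and metric) with the normalized Hamming distance $d(\sigma,\tau)=\frac1n|\{i:\sigma(i)\ne\tau(i)\}|$. $\varphi^{S_n}$ is the value of $\varphi$ in $S_n$ in continuous logic. *)

(* Defs.v *)
From HB Require Import structures.
From mathcomp Require Import all_boot all_order all_algebra all_fingroup.
From mathcomp Require Import all_classical all_reals all_analysis.
Set Implicit Arguments.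
Unset Strict Implicit.
Unset Printing Implicit Defensive.
Import Order.TTheory GRing.Theory Num.Theory.
Import numFieldNormedType.Exports.
Local Open Scope classical_set_scope.
Local Open Scope ring_scope.

(* Metric groups of diameter at most 1.  Completeness is not required: it plays
   no role in the interpretation of formulas, and it is automatic for the finite
   groups considered here. *)
Record bimetric_group (R : realType) := BimetricGroup {
  bg_sort :> groupType;
  bg_dist : bg_sort -> bg_sort -> R;
  bg_dist_ge0 : forall a b, 0 <= bg_dist a b;
  bg_dist_le1 : forall a b, bg_dist a b <= 1;
  bg_dist_eq0 : forall a b, bg_dist a b = 0 <-> a = b;
  bg_dist_sym : forall a b, bg_dist a b = bg_dist b a;
  bg_dist_triangle : forall a b c, bg_dist a c <= bg_dist a b + bg_dist b c;
  bg_dist_mull : forall c a b, bg_dist (c * a)%g (c * b)%g = bg_dist a b;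
  bg_dist_mulr : forall c a b, bg_dist (a * c)%g (b * c)%g = bg_dist a b
}.
Arguments bg_dist {R b} _ _ : rename.

Inductive term : Type :=
| Var of nat
| One
| Mul of term & term
| Inv of term.

Definition unit_cube (R : realType) (k : nat) : set 'rV[R]_k :=
  [set v | forall i, 0 <= v ord0 i <= 1].

(* Only the restriction of [conn_fun] to the cube [0,1]^k is meaningful. *)
Record connective (R : realType) (k : nat) := Connective {
  conn_fun :> 'rV[R]_k -> R;
  conn_continuous : {within @unit_cube R k, continuous conn_fun};
  conn_range : forall v, unit_cube v -> 0 <= conn_fun v <= 1
}.

Inductive formula (R : realType) : Type :=
| Dist of term & term
| Conn (k : nat) of connective R k & ('I_k -> formula R)
| Sup of nat & formula R
| Inf of nat & formula R.
Arguments Dist {R} _ _.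

Fixpoint quantifier_free (R : realType) (f : formula R) : Prop :=
  match f with
  | Dist _ _ => True
  | Conn _ _ fs => forall i, quantifier_free (fs i)
  | Sup _ _ | Inf _ _ => False
  end.

Fixpoint term_vars_in (vs : seq nat) (t : term) : bool :=
  match t with
  | Var v => v \in vs
  | One => true
  | Mul t1 t2 => term_vars_in vs t1 && term_vars_in vs t2
  | Inv t1 => term_vars_in vs t1
  end.

Fixpoint free_vars_in (R : realType) (vs : seq nat) (f : formula R) : Prop :=
  match f with
  | Dist t1 t2 => term_vars_in vs t1 && term_vars_in vs t2
  | Conn _ _ fs => forall i, free_vars_in vs (fs i)
  | Sup v g | Inf v g => free_vars_in (v :: vs) g
  end.

Definition update (T : Type) (s : nat -> T) (v : nat) (a : T) : nat -> T :=
  fun w => if w == v then a else s w.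

Fixpoint term_eval (G : groupType) (s : nat -> G) (t : term) : G :=
  match t with
  | Var v => s v
  | One => 1%g
  | Mul t1 t2 => (term_eval s t1 * term_eval s t2)%g
  | Inv t1 => (term_eval s t1)^-1%g
  end.

Fixpoint eval (R : realType) (G : bimetric_group R) (s : nat -> G)
    (f : formula R) : R :=
  match f with
  | Dist t1 t2 => bg_dist (term_eval s t1) (term_eval s t2)
  | Conn _ u fs => u (\row_i eval s (fs i))
  | Sup v g => sup (range (fun a : G => eval (update s v a) g))
  | Inf v g => inf (range (fun a : G => eval (update s v a) g))
  end.

(* Intended for sentences, on which the chosen assignment is irrelevant. *)
Definition value (R : realType) (G : bimetric_group R) (f : formula R) : R :=
  @eval R G (fun=> 1%g) f.

(* For n = 0 this is the zero distance on the trivial group, as 0^-1 = 0. *)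
Definition hamming (R : realType) (n : nat) (s t : 'S_n) : R :=
  #|[pred i : 'I_n | s i != t i]|%:R / n%:R.

Section Hamming.
Variables (R : realType) (n : nat).
Implicit Types a b c : 'S_n.

Lemma hamming_ge0 a b : 0 <= hamming R a b.
Proof. by rewrite /hamming divr_ge0. Qed.

Lemma hamming_le1 a b : hamming R a b <= 1.
Proof.
rewrite /hamming; have [n0|n0] := posnP n.
  by rewrite [X in _ / X%:R]n0 invr0 mulr0.
rewrite ler_pdivrMr ?ltr0n// mul1r ler_nat.
by rewrite (leq_trans (max_card _))// card_ord.
Qed.

Lemma hamming_eq0 a b : hamming R a b = 0 <-> a = b.
Proof.
split=> [/eqP|->]; last first.
  by rewrite /hamming eq_card0 ?mul0r// => i; rewrite !inE eqxx.
rewrite /hamming mulf_eq0 invr_eq0 !pnatr_eq0 => h.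
apply/permP => i; case/orP: h => [/eqP/card0_eq/(_ i)|/eqP n0].
  by rewrite !inE => /negbFE/eqP.
by have := ltn_ord i; rewrite [X in (_ < X)%N]n0.
Qed.

Lemma hamming_sym a b : hamming R a b = hamming R b a.
Proof.
by rewrite /hamming; congr (_%:R / _); apply: eq_card => i; rewrite !inE eq_sym.
Qed.

Lemma hamming_triangle a b c : hamming R a c <= hamming R a b + hamming R b c.
Proof.
rewrite /hamming -mulrDl ler_wpM2r ?invr_ge0// -natrD ler_nat -cardUI.
rewrite (leq_trans _ (leq_addr _ _))//.
apply/subset_leq_card/fintype.subsetP => i; rewrite !inE.
by apply: contraR; rewrite negb_or !negbK => /andP[/eqP-> /eqP->].
Qed.

Lemma hamming_mull c a b : hamming R (c * a)%g (c * b)%g = hamming R a b.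
Proof.
rewrite /hamming; congr (_%:R / _).
transitivity #|[preim c of [pred i | a i != b i]]|.
  by apply: eq_card => i; rewrite !inE !permM.
rewrite (card_preim (@perm_inj _ c)); apply: eq_card => i.
by rewrite !inE -[i in i \in _](permKV c) codom_f.
Qed.

Lemma hamming_mulr c a b : hamming R (a * c)%g (b * c)%g = hamming R a b.
Proof.
rewrite /hamming; congr (_%:R / _); apply: eq_card => i.
by rewrite !inE !permM (inj_eq perm_inj).
Qed.

End Hamming.

Definition sym_group (R : realType) (n : nat) : bimetric_group R :=
  @BimetricGroup R 'S_n (@hamming R n) (@hamming_ge0 R n) (@hamming_le1 R n)
    (@hamming_eq0 R n) (@hamming_sym R n) (@hamming_triangle R n)
    (@hamming_mull R n) (@hamming_mulr R n).

(* Main.v *)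
(* Write u_n for the value in S_n. It suffices to show that if u_n < c for
   infinitely many n, then u_m <= c + eps for all large m. Cutting long cycles
   moves a permutation by at most eps and leaves only cycles of bounded length;
   up to a further eps it is then determined, up to conjugacy, by finitely many
   rounded densities of cycle lengths. So infinitely many of the witnesses
   a in S_n of u_n < c share one such cycle type. Fix one of them, and let x'
   in S_m consist of about m/n copies of it. Any y_1, ..., y_k in S_m can be
   transported to S_b, for a witness a in S_b of the same type with b much
   larger than m: take about b/m copies of S_m and conjugate. This sends x'
   close to a and almost preserves distances, so psi(y, x') is at most
   sup_y psi(y, a) + eps < c + eps. *)

Require Import Defs.
From HB Require Import structures.
From mathcomp Require Import all_boot all_order all_algebra all_fingroup.
From mathcomp Require Import all_classical all_reals all_analysis.
From mathcomp Require Import zify ring lra.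
Set Implicit Arguments.
Unset Strict Implicit.
Unset Printing Implicit Defensive.
Import Order.TTheory GRing.Theory Num.Theory.
Import numFieldNormedType.Exports.
Local Open Scope classical_set_scope.
Local Open Scope ring_scope.

Local Notation eval := Defs.eval.

(** * Cutting long cycles, and matching cycles by conjugation *)

Section PermutationCombinatorics.
Local Open Scope nat_scope.
Variable T : finType.
Implicit Types (s t x z w c : {perm T}) (a p r : T).

Lemma permXS s i a : (s ^+ i.+1)%g a = s ((s ^+ i)%g a).
Proof. by rewrite expgSr permM. Qed.

Lemma card_porbit_le s a n : 0 < n -> (s ^+ n)%g a = a -> #|porbit s a| <= n.
Proof.
move=> n0 sna; have /subset_leq_card : porbit s a \subset traject s a n.
  apply/fintype.subsetP => _ /porbitP[i ->]; apply/trajectP; exists (i %% n).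
    by rewrite ltn_mod.
  rewrite -permX {1}(divn_eq i n) expgD mulnC expgM permM; congr (_ _).
  by elim: (i %/ n) => [|k IH]; rewrite ?perm1 // expgSr permM IH.
by move/leq_trans; apply; rewrite (leq_trans (card_size _)) ?size_traject.
Qed.

Lemma porbit_expgE s a i j :
  ((s ^+ i)%g a == (s ^+ j)%g a) = (i == j %[mod #|porbit s a|]).
Proof.
set n := #|porbit s a|; have n0 : 0 < n by rewrite lt0n card_porbit_neq0.
have red k : (s ^+ k)%g a = (s ^+ (k %% n))%g a.
  rewrite {1}(divn_eq k n) expgD mulnC expgM permM; congr (_ _).
  elim: (k %/ n) => [|l IH]; rewrite ?perm1 // expgSr permM IH.
  by rewrite permX iter_porbit.
rewrite (red i) (red j).
have nth_s k : k < n -> (s ^+ k)%g a = nth a (traject s a n) k.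
  by move=> kn; rewrite nth_traject // permX.
rewrite !nth_s ?ltn_mod //.
by rewrite nth_uniq ?size_traject ?ltn_mod ?uniq_traject_porbit.
Qed.

Lemma card_porbit_expg s a i : #|porbit s ((s ^+ i)%g a)| = #|porbit s a|.
Proof. by rewrite porbit_perm. Qed.

(** Multiplying by the transposition of [a] and [x^K a] closes the cycle of [a] after [K] steps.
    Only two points change their image, and the [K] points broken off no longer lie on a long
    cycle. *)
Lemma split_cycle K x a : 0 < K -> K.*2 <= #|porbit x a| ->
  exists x', [/\ #|[pred p | x' p != x p]| <= 2 &
    #|[pred p | K.*2 <= #|porbit x' p|]| + K
      <= #|[pred p | K.*2 <= #|porbit x p|]|].
Proof.
move=> K0 La; pose b := (x ^+ K)%g a; pose x' := (x * tperm a b)%g.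
have KL : K < #|porbit x a| by lia.
have modE i : i < #|porbit x a| -> i %% #|porbit x a| = i by apply: modn_small.
have ab : a != b.
  by rewrite -[a]perm1 -(expg0 x) porbit_expgE mod0n modE //; lia.
exists x'; split.
  have sub : [pred p | x' p != x p] \subset
      [set (x^-1)%g a; (x^-1)%g b]%SET.
    apply/fintype.subsetP => p; rewrite !inE /x' permM.
    by case: tpermP => [<-|<-|]; rewrite ?permK ?eqxx ?orbT.
  rewrite (leq_trans (subset_leq_card sub)) // cards2; by case: (_ != _).
have out p : p \notin porbit x a -> porbit x' p = porbit x p.
  move=> npa; have expE i : (x' ^+ i)%g p = (x ^+ i)%g p.
    elim: i => [|i IH]; first by rewrite !perm1.
    have nin q : q \in porbit x a -> (x ^+ i.+1)%g p != q.
      move=> qa; apply: contraNneq npa => e.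
      by rewrite porbit_sym -(porbit_perm x i.+1) e porbit_sym.
    rewrite [LHS]permXS IH permM -permXS tpermD //.
      by rewrite eq_sym nin ?porbit_id.
    by rewrite eq_sym nin ?mem_porbit.
  apply/setP => q; apply/porbitP/porbitP => -[i ->]; exists i;
  by rewrite expE.
have expE i : i < K -> (x' ^+ i)%g a = (x ^+ i)%g a.
  elim: i => [|i IH] iK; first by rewrite !perm1.
  rewrite permXS IH; last lia.
  rewrite permM -permXS tpermD // eq_sym.
    by rewrite -[X in _ != X]perm1 -(expg0 x) porbit_expgE mod0n modE //; lia.
  by rewrite porbit_expgE !modE //; lia.
have x'K : (x' ^+ K)%g a = a.
  rewrite -(prednK K0) permXS expE; last by lia.
  by rewrite permM -permXS prednK // tpermR.
have short i : i < K -> #|porbit x' ((x ^+ i)%g a)| <= K.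
  by move=> iK; rewrite -expE // card_porbit_expg card_porbit_le.
have cardK : #|traject x a K| = K.
  rewrite -[RHS](size_traject x a K); apply/card_uniqP.
  have := uniq_traject_porbit x a.
  rewrite -(subnKC (ltnW KL)) => U.
  rewrite [traject x a K](_ : _ =
      take K (traject x a (K + (#|porbit x a| - K)))); first exact: take_uniq.
  by rewrite take_traject //; lia.
rewrite -[X in _ + X]cardK -cardUI [X in _ + X]eq_card0 ?addn0; last first.
  move=> p; rewrite !inE; apply/negbTE/negP => /andP[lp /trajectP[i iK pE]].
  by move: lp; rewrite pE -permX leqNgt (leq_ltn_trans (short _ iK)) //; lia.
apply/subset_leq_card/fintype.subsetP => p.
have [pa _|npa] := boolP (p \in porbit x a).
  by rewrite inE; move: pa; rewrite -eq_porbit_mem => /eqP ->.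
rewrite !inE out // => /orP[//|/trajectP[i iK pE]].
by move: npa; rewrite pE -permX mem_porbit.
Qed.

Lemma cut_cycles K x : 0 < K -> exists w,
  (forall p, #|porbit w p| < K.*2) /\ K * #|[pred p | w p != x p]| <= 2 * #|T|.
Proof.
(* The induction runs on the number of points on long cycles: each cut changes at most 2 images and
   lowers that number by at least [K]. *)
move=> K0; suff: exists w, (forall p, #|porbit w p| < K.*2) /\
   K * #|[pred p | w p != x p]| <= 2 * #|[pred p | K.*2 <= #|porbit x p|]|.
  move=> [w [wK wx]]; exists w; split => //; apply: leq_trans wx _.
  by rewrite leq_mul2l max_card orbT.
have [n] := ubnP #|[pred p | K.*2 <= #|porbit x p|]|.
elim: n x => // n IH x; rewrite ltnS => xn.
have [/existsP[a La]|/existsPn noa] := boolP [exists a, K.*2 <= #|porbit x a|].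
  have [x' [x'x Lx']] := split_cycle K0 La.
  have [|w [wK wx']] := IH x'; first lia.
  exists w; split => //.
  have : #|[pred p | w p != x p]| <=
      #|[pred p | w p != x' p]| + #|[pred p | x' p != x p]|.
    rewrite -cardUI (leq_trans _ (leq_addr _ _)) //.
    apply/subset_leq_card/fintype.subsetP => p; rewrite !inE.
    by apply: contraR; rewrite negb_or !negbK => /andP[/eqP-> /eqP->].
  by nia.
exists x; split => [p|]; first by rewrite ltnNge noa.
by rewrite eq_card0 ?muln0 // => p; rewrite !inE eqxx.
Qed.

(** Take a permutation [c] agreeing with [g] at as many points of [D] as possible. If it failed at
    [p], composing it with the transposition of [c p] and [g p] would gain [p] and, by injectivity,
    lose nothing. *)
Lemma extend_injection (D : {set T}) (g : T -> T) :
  {in D &, injective g} -> exists c : {perm T}, {in D, c =1 g}.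
Proof.
move=> ginj; pose N (c : {perm T}) := #|[set p in D | c p == g p]%SET|.
case: (@arg_maxnP _ (1%g : {perm T}) xpredT N isT) => c _ cmax.
exists c => p pD.
apply/eqP; apply: contraT => cp.
suff: N c < N (c * tperm (c p) (g p))%g.
  by rewrite ltnNge => /negP[]; apply: cmax.
apply: proper_card; apply/properP; split; last first.
  by exists p; rewrite !inE pD ?permM ?tpermL ?eqxx // (negbTE cp).
apply/fintype.subsetP => q; rewrite !inE permM => /andP[qD /eqP cq].
rewrite qD tpermD -?cq ?eqxx //; apply: contraNneq cp.
  by move/perm_inj => ->; apply/eqP.
by rewrite cq => /(ginj _ _ pD qD) ->; apply/eqP.
Qed.

Definition cycle_points s i := #|[pred p | #|porbit s p| == i]|.

(** [None] marks the points outside the domain. The predicate is Boolean on a finite type, so that a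
    member with the largest domain can be chosen. *)
Definition equivariant_injection z w (g : {ffun T -> option T}) :=
  [forall p, forall r, (g p == Some r) ==> (g (z p) == Some (w r))] &&
  [forall p, forall q, forall r,
     (g p == Some r) && (g q == Some r) ==> (p == q)].

Lemma equivariant_injectionP z w (g : {ffun T -> option T}) : reflect
  ((forall p r, g p = Some r -> g (z p) = Some (w r)) /\
   (forall p q r, g p = Some r -> g q = Some r -> p = q))
  (equivariant_injection z w g).
Proof.
apply: (iffP andP) => -[h1 h2]; split.
- move=> p r /eqP gp; apply/eqP.
  by move/forallP/(_ p)/forallP/(_ r)/implyP: h1; apply.
- move=> p q r /eqP gp /eqP gq; apply/eqP.
  move/forallP/(_ p)/forallP/(_ q)/forallP/(_ r)/implyP: h2; apply.
  by rewrite gp gq.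
- by apply/forallP => p; apply/forallP => r; apply/implyP => /eqP/h1 ->.
- apply/forallP => p; apply/forallP => q; apply/forallP => r; apply/implyP.
  by move=> /andP[/eqP gp /eqP gq]; rewrite (h2 _ _ _ gp gq).
Qed.

(** The exponent is [j] times the orbit length [L]; hence the power [j * (L - 1)] undoes the power
    [j] on the orbit. *)
Lemma expg_porbit_mul s a j :
  (s ^+ (j * #|porbit s a|.-1 + j))%g a = a.
Proof.
apply/eqP; rewrite -[X in _ == X]perm1 -(expg0 s) porbit_expgE mod0n.
rewrite -mulnSr prednK ?modnMl //.
by rewrite lt0n card_porbit_neq0.
Qed.

Section EquivariantInjection.
Variables (z w : {perm T}) (g : {ffun T -> option T}).
Hypothesis geq : equivariant_injection z w g.

Lemma equivariant_expg i p r :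
  g p = Some r -> g ((z ^+ i)%g p) = Some ((w ^+ i)%g r).
Proof.
have [h _] := equivariant_injectionP _ _ _ geq.
by move=> gp; elim: i => [|i IH]; rewrite ?perm1 // !permXS; apply: h.
Qed.

(** Equivariance turns a period of [p] into one of [r], and injectivity turns a period of [r] into
    one of [p]. *)
Lemma equivariant_card_porbit p r :
  g p = Some r -> #|porbit z p| = #|porbit w r|.
Proof.
have [_ h] := equivariant_injectionP _ _ _ geq => gp.
apply/eqP; rewrite eqn_leq; apply/andP; split.
  rewrite card_porbit_le //; first by rewrite lt0n card_porbit_neq0.
  apply: (h _ _ r) => //; rewrite (equivariant_expg _ gp).
  by rewrite permX iter_porbit.
rewrite card_porbit_le //; first by rewrite lt0n card_porbit_neq0.
have := equivariant_expg #|porbit z p| gp.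
by rewrite {1}permX iter_porbit gp => -[].
Qed.

(** Send [z^j p] to [w^j r]; this is well defined and injective on the cycle because the two cycles
    have equal length. *)
Lemma equivariant_injection_extend p r :
    g p = None -> (forall q, g q != Some r) -> #|porbit z p| = #|porbit w r| ->
  exists2 g', equivariant_injection z w g' &
    #|[pred q | g q != None]| < #|[pred q | g' q != None]|.
Proof.
have [h1 h2] := equivariant_injectionP _ _ _ geq => gp gr szE.
pose g' : {ffun T -> option T} := [ffun q => if q \in porbit z p then
  Some ((w ^+ index q (traject z p #|porbit z p|))%g r) else g q].
have g'p j : g' ((z ^+ j)%g p) = Some ((w ^+ j)%g r).
  rewrite ffunE mem_porbit; congr Some; apply/eqP.
  rewrite porbit_expgE -szE -porbit_expgE.
  have mem : (z ^+ j)%g p \in traject z p #|porbit z p|.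
    by rewrite -porbit_traject mem_porbit.
  have lt := mem; rewrite -index_mem size_traject in lt.
  by rewrite [X in X == _]permX -(nth_traject z lt) nth_index.
have out q : q \notin porbit z p -> g' q = g q.
  by move=> nq; rewrite ffunE (negbTE nq).
(* If [g] already took a value on the cycle of [r], following that cycle around would show that it
   takes the value [r] itself. *)
have wr j q : g q != Some ((w ^+ j)%g r).
  apply: contraT => /negPn/eqP gq.
  have := equivariant_expg (j * #|porbit w r|.-1) gq.
  rewrite -permM -expgD addnC expg_porbit_mul => e.
  by have := gr ((z ^+ (j * #|porbit w r|.-1))%g q); rewrite e eqxx.
have zporb q : (z q \in porbit z p) = (q \in porbit z p).
  by rewrite -!eq_porbit_mem -[z q]/((z ^+ 1)%g q) porbit_perm.
exists g'.
  apply/equivariant_injectionP; split=> [q t|q q' t].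
    have [/porbitP[j ->]|nq] := boolP (q \in porbit z p).
      by rewrite g'p => -[<-]; rewrite -!permXS g'p.
    by rewrite !out ?zporb //; apply: h1.
  have [/porbitP[j ->]|nq] := boolP (q \in porbit z p);
  have [/porbitP[k ->]|nq'] := boolP (q' \in porbit z p); rewrite ?g'p ?out //.
  - move=> -[<-] [/eqP]; rewrite porbit_expgE -szE -porbit_expgE => /eqP; exact.
  - by move=> -[<-] /eqP; rewrite (negbTE (wr _ _)).
  - by move=> /[swap] -[<-] /eqP; rewrite (negbTE (wr _ _)).
  - exact: h2.
apply: proper_card; apply/properP; split; last first.
  exists p; rewrite !inE ?gp //.
  by have := g'p 0; rewrite !perm1 => ->.
apply/fintype.subsetP => q; rewrite !inE ffunE.
by case: ifP.
Qed.

End EquivariantInjection.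

(* A largest equivariant partial injection exhausts, for each length [i], the
   cycles of length [i] of [z] or those of [w]. *)
Lemma match_cycles B z w : (forall p, #|porbit z p| < B) -> exists c,
  #|[pred p | (z ^ c)%g p != w p]|
    <= \sum_(i < B) (cycle_points z i - cycle_points w i).
Proof.
move=> zB; pose N (g : {ffun T -> option T}) := #|[pred q | g q != None]|.
have g0 : equivariant_injection z w [ffun=> None].
  by apply/equivariant_injectionP; split=> [p r|p q r]; rewrite ffunE.
case: (@arg_maxnP _ _ (equivariant_injection z w) N g0) => g geq gmax.
have [h1 h2] := equivariant_injectionP _ _ _ geq.
pose D := [set p | g p != None]%SET; pose f p := odflt p (g p).
have fP p : p \in D -> g p = Some (f p).
  by rewrite inE /f; case: (g p).
have [c cf] : exists c : {perm T}, {in D, c =1 f}.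
  apply: extend_injection => p q pD qD fpq.
  by apply: (h2 _ _ (f p)); [apply: fP | rewrite fpq fP].
exists c.
(* Since [c] extends [g], which intertwines [z] and [w], disagreement is possible only on the image
   of the complement of [D]. *)
have conjE p : p \in D -> (z ^ c)%g (c p) = w (c p).
  move=> pD; have gzp := h1 _ _ (fP _ pD).
  have zpD : z p \in D by rewrite inE gzp.
  rewrite conjgE !permM permK !cf //.
  by apply: Some_inj; rewrite -fP.
apply: (@leq_trans #|~: D|).
  rewrite -(card_imset _ (@perm_inj _ c)); apply/subset_leq_card.
  apply/fintype.subsetP => q; rewrite inE => bad; apply/imsetP.
  exists (c^-1 q)%g; last by rewrite permKV.
  by rewrite inE; apply: contra bad => /conjE; rewrite permKV => ->.
have -> : #|~: D| =
    \sum_(i < B) #|[pred p | (p \notin D) && (#|porbit z p| == i)]|.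
  rewrite -sum1_card (partition_big (fun p => Ordinal (zB p)) xpredT) //=.
  apply: eq_bigr => i _; rewrite -sum1_card; apply: eq_bigl => p.
  by rewrite !inE -val_eqE.
apply: leq_sum => i _.
have [all_z|/forallPn [p]] :=
    boolP [forall p, (#|porbit z p| == i) ==> (p \in D)].
  rewrite eq_card0 // => p; rewrite !inE.
  have := forallP all_z p; rewrite !inE.
  by case: (_ == i :> nat); rewrite ?andbF //= => ->.
rewrite negb_imply => /andP[/eqP pi pD].
have cov r : #|porbit w r| = i -> exists2 q, q \in D & f q = r.
  move=> ri; have [/existsP[q /eqP gq]|/existsPn no] :=
      boolP [exists q, g q == Some r].
    by exists q; rewrite ?inE ?gq // /f gq.
  have gp : g p = None by apply/eqP; move: pD; rewrite !inE negbK.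
  have [g' g'eq] :=
    equivariant_injection_extend geq gp no (etrans pi (esym ri)).
  by rewrite ltnNge => /negP[]; apply: gmax.
pose E := [set q in D | #|porbit z q| == i]%SET.
have wE : cycle_points w i <= #|E|.
  apply: leq_trans (leq_imset_card f _); apply/subset_leq_card.
  apply/fintype.subsetP => r; rewrite inE => /eqP ri.
  have [q qD fq] := cov r ri; apply/imsetP; exists q => //.
  by rewrite inE qD (equivariant_card_porbit geq (fP _ qD)) fq ri eqxx.
have -> : cycle_points z i =
    #|E| + #|[pred q | (q \notin D) && (#|porbit z q| == i)]|.
  rewrite -[LHS](cardID D); congr (_ + _); apply: eq_card => q; rewrite !inE //.
  by rewrite andbC.
by lia.
Qed.

End PermutationCombinatorics.

(** * Diagonal copies of a permutation on a larger set *)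

Section Amplification.
Local Open Scope nat_scope.
Variables (A U T : finType) (e : A * U -> T).
Hypothesis e_inj : injective e.
Implicit Types s t : {perm U}.

(** The diagonal action: [e] embeds disjoint copies of [U], indexed by [A], and the points outside
    all copies are fixed. *)
Definition amplify_fun s (p : T) : T :=
  if [pick u | e u == p] is Some u then e (u.1, s u.2) else p.

Lemma amplify_fun_in s k r : amplify_fun s (e (k, r)) = e (k, s r).
Proof.
rewrite /amplify_fun; case: pickP => [u /eqP/e_inj -> //|/(_ (k, r))].
by rewrite eqxx.
Qed.

Lemma amplify_fun_out s p : p \notin codom e -> amplify_fun s p = p.
Proof.
rewrite /amplify_fun; case: pickP => // u /eqP <-.
by rewrite codom_f.
Qed.

Lemma amplifyP p : (exists k r, p = e (k, r)) \/ p \notin codom e.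
Proof.
have [/codomP[[k r] ->]|] := boolP (p \in codom e); [left|by right].
by exists k, r.
Qed.

Lemma amplify_funM s t p :
  amplify_fun (s * t)%g p = amplify_fun t (amplify_fun s p).
Proof.
have [[k [r ->]]|np] := amplifyP p; first by rewrite !amplify_fun_in permM.
by rewrite !amplify_fun_out.
Qed.

Lemma amplify_fun1 p : amplify_fun 1%g p = p.
Proof.
have [[k [r ->]]|np] := amplifyP p; first by rewrite !amplify_fun_in perm1.
by rewrite !amplify_fun_out.
Qed.

Lemma amplify_fun_inj s : injective (amplify_fun s).
Proof.
by apply: (can_inj (g := amplify_fun s^-1%g)) => p;
  rewrite -amplify_funM mulgV amplify_fun1.
Qed.

Definition amplify s : {perm T} := perm (@amplify_fun_inj s).

Lemma amplify_in s k r : amplify s (e (k, r)) = e (k, s r).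
Proof. by rewrite permE amplify_fun_in. Qed.

Lemma amplify_out s p : p \notin codom e -> amplify s p = p.
Proof. by rewrite permE; exact: amplify_fun_out. Qed.

Lemma amplifyM : {morph amplify : s t / (s * t)%g}.
Proof. by move=> s t; apply/permP => p; rewrite permM !permE amplify_funM. Qed.

Lemma amplify1 : amplify 1%g = 1%g.
Proof. by apply/permP => p; rewrite perm1 permE amplify_fun1. Qed.

Lemma amplifyX s i : amplify (s ^+ i)%g = (amplify s ^+ i)%g.
Proof. by elim: i => [|i IH]; rewrite ?amplify1 // !expgS amplifyM IH. Qed.

Lemma card_porbit_amplify s k r :
  #|porbit (amplify s) (e (k, r))| = #|porbit s r|.
Proof.
rewrite -(card_imset (f := fun q => e (k, q)) (mem (porbit s r))); last first.
  by move=> q q' /e_inj [].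
congr #|pred_of_set _|; apply/setP => p; apply/porbitP/imsetP.
  move=> [i ->]; exists ((s ^+ i)%g r); rewrite ?mem_porbit //.
  by rewrite -amplifyX amplify_in.
by move=> [_ /porbitP[i ->] ->]; exists i; rewrite -amplifyX amplify_in.
Qed.

Lemma card_porbit_amplify_out s p :
  p \notin codom e -> #|porbit (amplify s) p| = 1.
Proof.
move=> np; apply/eqP; rewrite eqn_leq lt0n card_porbit_neq0 andbT.
by apply: card_porbit_le => //; rewrite expg1 amplify_out.
Qed.

Lemma card_amplified (P : pred U) (Q : pred T) :
  (forall k r, P r -> Q (e (k, r))) -> #|A| * #|P| <= #|Q|.
Proof.
move=> PQ; rewrite -[X in X * _]cardsT -[X in _ * X]cardsE -cardsX.
rewrite -(card_imset _ e_inj); apply/subset_leq_card/fintype.subsetP => p.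
move=> /imsetP[[k r]]; rewrite !inE /= => Pr ->.
exact: PQ.
Qed.

End Amplification.

(** Inside the copies the density is exact, so the error comes from fewer than [#|U|] leftover
    points. Counting the complement of [P] as well bounds [#|Q|] from both sides. *)
Lemma amplified_density (R : realType) (A U T : finType) (e : A * U -> T)
    (P : pred U) (Q : pred T) :
    injective e -> (0 < #|U|)%N -> (0 < #|T|)%N ->
    (#|T| < (#|A| * #|U|) + #|U|)%N -> (forall k r, Q (e (k, r)) = P r) ->
  `| #|Q|%:R / #|T|%:R - #|P|%:R / #|U|%:R | <= #|U|%:R / #|T|%:R :> R.
Proof.
move=> e_inj U0 T0 Tlt PQ.
have lo : (#|A| * #|P| <= #|Q|)%N.
  by apply: (card_amplified e_inj) => k r Pr; rewrite PQ.
have hi : (#|A| * #|predC P| <= #|predC Q|)%N.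
  by apply: (card_amplified e_inj) => k r; rewrite /= PQ.
have AU : (#|A| * #|U| <= #|T|)%N.
  by have := leq_card _ e_inj; rewrite card_prod.
have := cardC Q; have := cardC P; move: hi lo.
move: #|predC P| #|predC Q| U0 T0 Tlt AU.
move: #|A| #|P| #|Q| #|T| #|U| => a p q t u p' q' u0 t0 tlt au hi lo eu et.
have ut0 : 0 < u%:R * t%:R :> R by rewrite -natrM ltr0n muln_gt0 u0.
have -> : q%:R / t%:R - p%:R / u%:R =
    (q%:R * u%:R - p%:R * t%:R) / (u%:R * t%:R) :> R.
  by field; rewrite !pnatr_eq0 -!lt0n u0 t0.
have -> : u%:R / t%:R = (u%:R * u%:R) / (u%:R * t%:R) :> R.
  by field; rewrite !pnatr_eq0 -!lt0n u0 t0.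
rewrite normrM [X in _ * X]ger0_norm ?invr_ge0 ?(ltW ut0) //.
rewrite ler_pM2r ?invr_gt0 // ler_distl lerBlDr -!natrM -!natrD !ler_nat.
by apply/andP; split; nia.
Qed.

(** * Connectives and the semantics of quantifiers *)

(** Heine-Cantor on the compact cube; continuity is given only within the cube, hence the relative
    form of the covering property. *)
Lemma connective_uniformly_continuous (R : realType) k (u : connective R k)
    (eps : R) : 0 < eps ->
  exists2 delta : R, 0 < delta &
    forall v v' : 'rV[R]_k, unit_cube v -> unit_cube v' ->
      (forall i, `|v ord0 i - v' ord0 i| < delta) -> `|u v - u v'| <= eps.
Proof.
move=> eps0.
have cK : compact (@unit_cube R k).
  have := @rV_compact R k (fun=> `[0, 1]%classic)
    (fun=> @segment_compact R 0 1).
  by congr compact; apply/seteqP; split => v /= h i;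
    have := h i; rewrite /= in_itv.
pose P d (v : 'rV[R]_k) := forall v', unit_cube v' ->
  (forall i, `|v ord0 i - v' ord0 i| < d) -> `|u v - u v'| <= eps.
have /compact_near_coveringP/near_covering_withinP cov := cK.
have : \forall d \near 0^'+, @unit_cube R k `<=` P d.
  apply: (cov _ _ P (at_right_proper_filter (0 : R))) => v Kv.
  have uc := @conn_continuous R k u.
  move/(subspace_continuousP _ _)/(_ v Kv)/cvgrPdist_lt/(_ (eps / 2)) : uc.
  rewrite divr_gt0 // => /(_ isT) /nbhs_ballP[r /= r0 vr].
  (* With both radii halved, [v1] and [v2] lie in the ball of radius [r] around [v]. *)
  exists (ball v (r / 2), [set d : R | d < r / 2]).
    split; first by apply: nbhsx_ballx; rewrite divr_gt0.
    by apply: nbhs_right_lt; rewrite divr_gt0.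
  move=> [v1 d] /= [v1v dr] Kv1 v2 Kv2 v12.
  have e1 : `|u v - u v1| < eps / 2.
    apply: vr => //; apply: le_ball v1v; lra.
  have e2 : `|u v - u v2| < eps / 2.
    apply: vr => //.
    rewrite (splitr r); apply: ball_triangle v1v _.
    rewrite /ball /= /mx_ball; split=> [|i j]; first by rewrite divr_gt0.
    rewrite !ord1 /ball /=.
    exact: lt_trans (v12 _) dr.
  rewrite -[u v1 - u v2](subrKA (u v)) (splitr eps).
  by rewrite (le_trans (ler_normD _ _)) // lerD // ltW // distrC.
move=> /(filterI (nbhs_right_gt (0 : R)))/filter_ex[d [d0 h]].
by exists d => // v v' Kv Kv' vv'; exact: h.
Qed.

(** Bounds the sets over which the quantifiers range, so that [sup] and [inf] are genuine and not
    default values. *)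
Lemma eval_itv (R : realType) (G : bimetric_group R) (f : formula R)
    (s : nat -> G) : 0 <= eval s f <= 1.
Proof.
elim: f s => [t1 t2 s|k u fs IH s|v f IH s|v f IH s] /=.
- by rewrite bg_dist_ge0 bg_dist_le1.
- by apply: conn_range => i; rewrite mxE.
- have ub : ubound (range (fun a : G => eval (update s v a) f)) 1.
    by move=> _ [a _ <-]; have /andP[] := IH (update s v a).
  have ne : range (fun a : G => eval (update s v a) f) !=set0.
    by exists (eval (update s v 1%g) f); exists 1%g.
  apply/andP; split; last exact: ge_sup.
  apply: (@le_trans _ _ (eval (update s v 1%g) f)).
    by have /andP[] := IH (update s v 1%g).
  by apply: sup_upper_bound; [split=> //; exists 1 | exists 1%g].
- have lb : lbound (range (fun a : G => eval (update s v a) f)) 0.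
    by move=> _ [a _ <-]; have /andP[] := IH (update s v a).
  have ne : range (fun a : G => eval (update s v a) f) !=set0.
    by exists (eval (update s v 1%g) f); exists 1%g.
  apply/andP; split; first exact: lb_le_inf.
  apply: (@le_trans _ _ (eval (update s v 1%g) f)).
    by apply: ge_inf; [exists 0 | exists 1%g].
  by have /andP[] := IH (update s v 1%g).
Qed.

Lemma has_sup_eval (R : realType) (G : bimetric_group R) (f : formula R) v
    (s : nat -> G) : has_sup (range (fun a : G => eval (update s v a) f)).
Proof.
split; first by exists (eval (update s v 1%g) f); exists 1%g.
by exists 1 => _ [a _ <-]; have /andP[] := eval_itv f (update s v a).
Qed.

Lemma eval_sup_le (R : realType) (G : bimetric_group R) (f : formula R)
    ys (s s' : nat -> G) : (forall v, v \notin ys -> s' v = s v) ->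
  eval s' f <= eval s (foldr (@Sup R) f ys).
Proof.
elim: ys s => [|y ys IH] s agree /=.
  by rewrite (_ : s' = s) //; apply/funext => v; rewrite agree.
apply: (@le_trans _ _ (eval (update s y (s' y)) (foldr (@Sup R) f ys))).
  apply: IH => v nv; rewrite /update; case: eqP => [->//|/eqP vy].
  by rewrite agree // inE negb_or vy.
by apply: sup_upper_bound; [exact: has_sup_eval | exists (s' y)].
Qed.

(** A supremum need not be attained in a general [G]; halving the error at each quantifier keeps the
    total below [eps]. *)
Lemma eval_sup_adherent (R : realType) (G : bimetric_group R) (f : formula R)
    ys (s : nat -> G) (eps : R) : 0 < eps ->
  exists2 s', (forall v, v \notin ys -> s' v = s v) &
    eval s (foldr (@Sup R) f ys) - eps < eval s' f.
Proof.
elim: ys s eps => [|y ys IH] s eps eps0 /=.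
  by exists s => //; rewrite ltrBlDr ltrDl.
have eps20 : 0 < eps / 2 by rewrite divr_gt0.
have [_ [a _ <-] ha] := sup_adherent eps20
  (has_sup_eval (foldr (@Sup R) f ys) y s).
have [s' agree hs'] := IH (update s y a) _ eps20.
exists s' => [v|].
  by rewrite inE negb_or => /andP[vy /agree ->]; rewrite /update (negbTE vy).
by move: (eval _ _) (sup _) (eval _ _) ha hs' => A B C; lra.
Qed.

(** * Quantifier-free formulas under almost isometric homomorphisms *)

(** Counts occurrences of variables only: a homomorphism is exact on the group operations, so each
    variable is the sole source of error. *)
Fixpoint term_size (t : term) : nat :=
  match t with
  | Var _ => 1
  | One => 0
  | Mul t1 t2 => term_size t1 + term_size t2
  | Defs.Inv t1 => term_size t1
  end.

Lemma bg_distM (R : realType) (G : bimetric_group R) (a b c d : G) :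
  bg_dist (a * b)%g (c * d)%g <= bg_dist a c + bg_dist b d.
Proof.
apply: le_trans (bg_dist_triangle _ (c * b)%g _) _.
by rewrite bg_dist_mulr bg_dist_mull.
Qed.

Lemma bg_distV (R : realType) (G : bimetric_group R) (a b : G) :
  bg_dist a^-1%g b^-1%g = bg_dist a b.
Proof.
rewrite -(bg_dist_mull a) mulgV -(bg_dist_mulr b) mul1g mulgVK.
exact: bg_dist_sym.
Qed.

Section AlmostIsometry.
Variables (R : realType) (G H : bimetric_group R) (h : G -> H) (delta : R).
Hypothesis hM : {morph h : a b / (a * b)%g}.
Hypothesis h_isom : forall a b, `|bg_dist (h a) (h b) - bg_dist a b| <= delta.
Variables (s : nat -> G) (s' : nat -> H).
Hypothesis close : forall v, bg_dist (h (s v)) (s' v) <= delta.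

(** By bi-invariance, errors add up under products and are unchanged by inversion. *)
Lemma term_eval_close t :
  bg_dist (h (term_eval s t)) (term_eval s' t) <= (term_size t)%:R * delta.
Proof.
have h1 : h 1%g = 1%g.
  by apply: (@mulgI _ (h 1%g)); rewrite -hM !mulg1.
have hV a : h a^-1%g = (h a)^-1%g.
  by apply: (@mulgI _ (h a)); rewrite -hM !mulgV.
elim: t => [v||t1 IH1 t2 IH2|t IH] /=.
- by rewrite mul1r.
- by rewrite h1 mul0r (bg_dist_eq0 _ _).2.
- by rewrite hM natrD mulrDl (le_trans (bg_distM _ _ _ _)) // lerD.
- by rewrite hV bg_distV.
Qed.

(** The summand 1 pays for the distortion by [h], the two sizes for the displacement of the two
    terms. *)
Lemma dist_close t1 t2 :
  `|bg_dist (term_eval s t1) (term_eval s t2)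
    - bg_dist (term_eval s' t1) (term_eval s' t2)|
     <= (1 + term_size t1 + term_size t2)%:R * delta.
Proof.
have c1 := term_eval_close t1; have c2 := term_eval_close t2.
have := h_isom (term_eval s t1) (term_eval s t2).
move: (term_eval s t1) (term_eval s t2) c1 c2.
move: (term_eval s' t1) (term_eval s' t2) => a' b' a b c1 c2.
have := bg_dist_triangle (h a) a' (h b).
have := bg_dist_triangle a' b' (h b).
have := bg_dist_triangle a' (h a) b'.
have := bg_dist_triangle (h a) (h b) b'.
rewrite (bg_dist_sym a' (h a)) (bg_dist_sym b' (h b)).
rewrite !natrD !mulrDl mul1r !ler_distl.
move: (bg_dist a b) (bg_dist (h a) (h b)) (bg_dist (h a) b') (bg_dist a' b')
  (bg_dist a' (h b)) c1 c2.
move: (bg_dist (h a) a') (bg_dist (h b) b').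
by move=> *; lra.
Qed.

End AlmostIsometry.

(* The same [delta] works for all metric groups [G] and [H] at once. *)
Lemma qf_eval_close (R : realType) (f : formula R) (eps : R) :
    quantifier_free f -> 0 < eps ->
  exists2 delta : R, 0 < delta &
    forall (G H : bimetric_group R) (h : G -> H) (s : nat -> G) (s' : nat -> H),
      {morph h : a b / (a * b)%g} ->
      (forall a b, `|bg_dist (h a) (h b) - bg_dist a b| <= delta) ->
      (forall v, bg_dist (h (s v)) (s' v) <= delta) ->
    `|eval s f - eval s' f| <= eps.
Proof.
move=> + eps0; elim: f eps eps0 => [t1 t2|k u fs IH|//|//] eps eps0 /=.
  move=> _; pose N := (1 + term_size t1 + term_size t2)%N.
  have N0 : 0 < N%:R :> R by rewrite ltr0n.
  exists (eps / N%:R); first by rewrite divr_gt0.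
  move=> G H h s s' hM h_isom close.
  apply: le_trans (dist_close hM h_isom close _ _) _.
  by rewrite -/N mulrC divfK // gt_eqF.
move=> qf; have [d d0 hu] := connective_uniformly_continuous u eps0.
(* The modulus of continuity asks for a strict bound by [d], while the induction hypothesis gives a
   weak one. *)
have d20 : 0 < d / 2 by rewrite divr_gt0.
have {IH} /choice[D hD] : forall i, exists delta : R, 0 < delta /\
    forall (G H : bimetric_group R) (h : G -> H) (s : nat -> G) (s' : nat -> H),
      {morph h : a b / (a * b)%g} ->
      (forall a b, `|bg_dist (h a) (h b) - bg_dist a b| <= delta) ->
      (forall v, bg_dist (h (s v)) (s' v) <= delta) ->
    `|eval s (fs i) - eval s' (fs i)| <= d / 2.
  by move=> i; have [e e0 he] := IH i _ d20 (qf i); exists e.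
(* The default 1 keeps the minimum positive when the connective has no arguments. *)
exists (\big[Num.min/1]_i D i).
  apply: (big_ind (fun x => 0 < x)) => // [a b a0 b0|i _].
    by rewrite lt_min a0.
  by case: (hD i).
move=> G H h s s' hM h_isom close; apply: hu.
- by move=> i; rewrite mxE eval_itv.
- by move=> i; rewrite mxE eval_itv.
move=> i; rewrite !mxE.
have le : \big[Num.min/1]_i D i <= D i by apply: bigmin_le_cond.
apply: le_lt_trans (_ : d / 2 < d); last lra.
apply: ((hD i).2 _ _ h s s' hM) => [a b|v].
  exact: le_trans (h_isom a b) le.
exact: le_trans (close v) le.
Qed.

(** * Limits and the pigeonhole principle *)

Lemma eventually_div_le (R : realType) (A eta : R) : 0 < eta ->
  exists N : nat, forall n, (N <= n)%N -> (0 < n)%N /\ A / n%:R <= eta.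
Proof.
move=> eta0; exists (Num.truncn (A / eta)).+1 => n Nn.
have n0 : (0 < n)%N by exact: leq_trans Nn.
split=> //; rewrite ler_pdivrMr ?ltr0n // mulrC -ler_pdivrMr //.
by apply: le_trans (ltW (truncnS_gt _)) _; rewrite ler_nat.
Qed.

(** If each element of [F] stopped occurring at some stage, nothing would occur past the largest of
    these stages. *)
Lemma frequently_pigeonhole (F : finType) (P : nat -> F -> Prop) :
  (forall N, exists2 n, (N <= n)%N & exists t, P n t) ->
  exists t, forall N, exists2 n, (N <= n)%N & P n t.
Proof.
move=> freq; apply: contrapT => /forallNP no.
have {no} /choice[N hN] : forall t, exists N, forall n, (N <= n)%N -> ~ P n t.
  move=> t; have /existsNP[N hN] := no t.
  by exists N => n Nn Pn; apply: hN; exists n.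
have [n Nn [t]] := freq (\max_t N t).
by apply: hN; apply: leq_trans Nn; apply: leq_bigmax.
Qed.

(** The second hypothesis forces the limit superior to be at most the limit inferior. *)
Lemma bounded_cvg_of_frequently (R : realType) (u : nat -> R) :
    (forall n, 0 <= u n <= 1) ->
    (forall c eps, 0 < eps -> (forall N, exists2 n, (N <= n)%N & u n < c) ->
      exists N, forall n, (N <= n)%N -> u n <= c + eps) ->
  cvg (u @ \oo).
Proof.
move=> u01 step.
(* The supremum of [E] is the limit inferior of [u]. *)
pose E := [set l : R | exists N, forall n, (N <= n)%N -> l <= u n].
have supE : has_sup E.
  split; first by exists 0; exists 0%N => n _; have /andP[] := u01 n.
  exists 1 => l [N /(_ N (leqnn _)) lu]; apply: le_trans lu _.
  by have /andP[] := u01 N.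
apply/cvg_ex; exists (sup E); apply/cvgrPdist_le => eps eps0.
have eps20 : 0 < eps / 2 by rewrite divr_gt0.
have [l [N1 hl] ltl] := sup_adherent eps20 supE.
have [N2 hN2] : exists N, forall n, (N <= n)%N ->
    u n <= sup E + eps / 2 + eps / 2.
  (* Here [c] is [sup E + eps / 2]; if [u n < c] failed from some stage on, [c] would belong to
     [E]. *)
  apply: step => // N; apply: contrapT => no.
  have : E (sup E + eps / 2).
    exists N => n Nn; rewrite leNgt; apply/negP => un.
    by apply: no; exists n.
  by move/(sup_upper_bound supE); rewrite leNgt ltrDl eps20.
exists (maxn N1 N2) => // n /= ; rewrite geq_max => /andP[/hl h1 /hN2 h2].
by rewrite ler_distl; move: (sup E) ltl h1 h2 => S *; lra.
Qed.

(** * Cycle densities in symmetric groups *)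

Definition cycle_density (R : realType) (n : nat) (s : 'S_n) (i : nat) : R :=
  (cycle_points s i)%:R / n%:R.

(** A coarse cycle type with finitely many values, the same for all [n]: densities are rounded down
    to multiples of [1/M]. For positive [n] the quotient is at most [M], so [inord] does not fall
    back on its default. *)
Definition cycle_type (B M n : nat) (s : 'S_n) : {ffun 'I_B -> 'I_M.+1} :=
  [ffun i : 'I_B => inord ((cycle_points s i * M) %/ n)].

(** Both densities lie in the interval of length [1/M] determined by the common quotient. *)
Lemma cycle_type_density (R : realType) B M n m (s : 'S_n) (t : 'S_m)
    (i : 'I_B) : (0 < n)%N -> (0 < m)%N -> (0 < M)%N ->
    cycle_type B M s = cycle_type B M t ->
  `|cycle_density R s i - cycle_density R t i| <= M%:R^-1.
Proof.
move=> n0 m0 M0 /ffunP/(_ i); rewrite !ffunE => /(congr1 val).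
have cc k (r : 'S_k) : (cycle_points r i <= k)%N.
  by rewrite -[X in (_ <= X)%N]card_ord max_card.
have bnd k (r : 'S_k) : (0 < k)%N -> ((cycle_points r i * M) %/ k < M.+1)%N.
  move=> k0; rewrite ltnS -[X in (_ <= X)%N](mulKn M k0) leq_div2r //.
  by rewrite leq_mul2r cc orbT.
rewrite /= !inordK ?bnd // /cycle_density.
move: (cc _ s) (cc _ t); move: (cycle_points s i) (cycle_points t i) => a b.
move=> _ _ qE.
pose q := ((a * M) %/ n)%N.
have itv (d k : nat) : (0 < k)%N -> ((d * M) %/ k)%N = q ->
    q%:R / M%:R <= d%:R / k%:R :> R /\
    d%:R / k%:R <= q%:R / M%:R + M%:R^-1 :> R.
  move=> k0 dk; have k0' : 0 < k%:R :> R by rewrite ltr0n.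
  have M0' : 0 < M%:R :> R by rewrite ltr0n.
  split.
    rewrite ler_pdivrMr // mulrAC ler_pdivlMr // -!natrM ler_nat -dk.
    exact: leq_trunc_div.
  rewrite -[X in _ <= _ + X]mul1r -mulrDl ler_pdivrMr // mulrAC ler_pdivlMr //.
  by rewrite natr1 -!natrM ler_nat -dk ltnW // ltn_ceil.
have [a1 a2] := itv a n n0 erefl; have [b1 b2] := itv b m m0 (esym qE).
by rewrite ler_distl; lra.
Qed.

(** Take [m %/ n] diagonal copies, which leaves fewer than [n] points. Hamming distances and cycle
    densities are both densities of sets, hence the same error. The leftover points form cycles of
    length 1, whence [1 < B]. *)
Lemma amplification (R : realType) (n m : nat) : (0 < n)%N -> (0 < m)%N ->
  exists h : 'S_n -> 'S_m,
  [/\ {morph h : a b / (a * b)%g},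
      forall a b, `|hamming R (h a) (h b) - hamming R a b| <= n%:R / m%:R,
      forall s i, `|cycle_density R (h s) i - cycle_density R s i|
        <= n%:R / m%:R &
      forall s B, (1 < B)%N -> (forall p, #|porbit s p| < B)%N ->
        forall p, (#|porbit (h s) p| < B)%N].
Proof.
move=> n0 m0; have le : (#|{: 'I_(m %/ n) * 'I_n}| <= m)%N.
  by rewrite card_prod !card_ord leq_trunc_div.
pose e (u : 'I_(m %/ n) * 'I_n) : 'I_m := widen_ord le (enum_rank u).
have e_inj : injective e.
  by move=> u v /(congr1 val) /= /val_inj /enum_rank_inj.
have dens P Q : (forall k r, Q (e (k, r)) = P r) ->
    `| #|Q|%:R / m%:R - #|P|%:R / n%:R | <= n%:R / m%:R :> R.
  move=> PQ; have := @amplified_density R _ _ _ e P Q e_inj.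
  rewrite !card_ord; apply => //.
  by rewrite -mulSnr ltn_ceil.
exists (amplify e_inj); split.
- exact: amplifyM.
- move=> a b; apply: dens => k r /=.
  by rewrite !amplify_in (inj_eq e_inj) xpair_eqE eqxx.
- move=> s i; apply: dens => k r /=.
  by rewrite card_porbit_amplify.
- move=> s B B1 sB p; have [[k [r ->]]|np] := amplifyP e p.
    by rewrite card_porbit_amplify.
  by rewrite card_porbit_amplify_out.
Qed.

(** Each of the [B] cycle lengths contributes at most [eta] to the proportion of unmatched
    points. *)
Lemma match_hamming (R : realType) (b B : nat) (z w : 'S_b) (eta : R) :
    (0 < b)%N -> (forall p, #|porbit z p| < B)%N ->
    (forall i : 'I_B, `|cycle_density R z i - cycle_density R w i| <= eta) ->
  exists c, hamming R (z ^ c)%g w <= B%:R * eta.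
Proof.
move=> b0 zB dens; have [c hc] := match_cycles w zB; exists c.
have b0' : 0 < b%:R :> R by rewrite ltr0n.
rewrite /hamming ler_pdivrMr //.
apply: (@le_trans _ _ (\sum_(i < B) (eta * b%:R))).
  apply: (@le_trans _ _
      (\sum_(i < B) (cycle_points z i - cycle_points w i)%N)%:R).
    by rewrite ler_nat.
  rewrite natr_sum; apply: ler_sum => i _.
  have := dens i; rewrite /cycle_density -mulrBl normrM.
  rewrite [X in _ * X]gtr0_norm ?invr_gt0 // ler_pdivrMr //.
  move=> /(le_trans _); apply.
  (* The subtraction is truncated: where [w] has the surplus, the term is 0. *)
  have [le|/ltnW le] := leqP (cycle_points w i) (cycle_points z i).
    by rewrite natrB // ler_norm.
  by rewrite (eqP (_ : (_ - _)%N == 0%N)) ?subn_eq0 // normr_ge0.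
by rewrite sumr_const card_ord -[leLHS]mulr_natl mulrA.
Qed.

(** * Transport of witnesses between symmetric groups *)

Section Transport.
Variables (R : realType) (x : nat) (ys : seq nat) (psi : formula R).
Hypothesis x_notin : x \notin ys.
Hypothesis psi_qf : quantifier_free psi.

Definition sup_at n (a : sym_group R n) : R :=
  eval (update (fun=> 1%g) x a) (foldr (@Sup R) psi ys).

Lemma eventually_value_le (c eps : R) : 0 < eps ->
    (forall N, exists2 n, (N <= n)%N &
      value (sym_group R n) (Inf x (foldr (@Sup R) psi ys)) < c) ->
  exists N, forall n, (N <= n)%N ->
    value (sym_group R n) (Inf x (foldr (@Sup R) psi ys)) <= c + eps.
Proof.
move=> eps0 freq.
have eps20 : 0 < eps / 2 by rewrite divr_gt0.
have [delta delta0 close] := qf_eval_close psi_qf eps20.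
(* Four errors share [delta]: cutting cycles ([K]), rounding densities ([M]), passing from [S_n0] to
   [S_m] ([N]) and from [S_m] to [S_b] ([b0']). *)
have d40 : 0 < delta / 4 by rewrite divr_gt0.
have [K /(_ _ (leqnn _)) [K0 K4]] := eventually_div_le 2 d40.
pose B := K.*2.
have [M /(_ _ (leqnn _)) [M0 M4]] := eventually_div_le B%:R d40.
have B1 : (1 < B)%N by rewrite /B; lia.
(* Here [a] is the witness and [w] its approximation with short cycles, whose type is recorded. *)
pose P n (t : {ffun 'I_B -> 'I_M.+1}) := exists a w : 'S_n,
  [/\ sup_at a < c, hamming R w a <= delta / 4,
      forall p, (#|porbit w p| < B)%N & cycle_type B M w = t].
have [t ht] : exists t, forall N, exists2 n, (N <= n)%N & P n t.
  apply: frequently_pigeonhole => N.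
  (* The maximum with 1 excludes [n = 0], where densities degenerate. *)
  have [n Nn vc] := freq (maxn N 1); rewrite geq_max in Nn.
  case/andP: Nn => Nn n0; exists n => //.
  have [|_ [a _ <-] ac] := inf_lt _ vc.
    by exists (sup_at (1%g : sym_group R n)); exists 1%g.
  have [w [wB wa]] := cut_cycles (a : 'S_n) K0.
  exists (cycle_type B M w), a, w; split=> //.
  apply: le_trans K4; rewrite /hamming ler_pdivrMr ?ltr0n // mulrAC.
  rewrite ler_pdivlMr ?ltr0n // -!natrM ler_nat mulnC.
  by move: wa; rewrite card_ord.
(* The model [w0] is fixed before [m], so the threshold [N] may depend on [n0]. *)
have [n0 n00 [a0 [w0 [_ _ w0B w0t]]]] := ht 1%N.
have [N hN] := eventually_div_le (B%:R * n0%:R) d40.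
exists N => m /hN[m0 mB].
have [h1 [_ _ h1d h1B]] := amplification R n00 m0.
pose x' : sym_group R m := h1 w0.
have x'B := h1B _ _ B1 w0B.
suff lex' : sup_at x' <= c + eps.
  apply: le_trans lex'; apply: ge_inf; last by exists x'.
  exists 0 => _ [a _ <-].
  by have /andP[] := eval_itv (foldr (@Sup R) psi ys) (update (fun=> 1%g) x a).
have [s s_out ltS] := eval_sup_adherent psi ys (update (fun=> 1%g) x x') eps20.
have [b0' hb0] := eventually_div_le (B%:R * m%:R) d40.
have [b /hb0[b0 bB] [a [w [ac wa wB wt]]]] := ht b0'.
have [h2 [h2M h2i h2d h2B]] := amplification R m0 b0.
have x'E : s x = x' by rewrite s_out // /update eqxx.
(* The three terms compare [h2 x'] with [x'], [x'] with [w0], and [w0] with [w], the last pair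
   having the same rounded type. *)
have [i|g hg] := @match_hamming R b B (h2 x') w
    (m%:R / b%:R + n0%:R / m%:R + M%:R^-1) b0 (h2B _ _ B1 x'B).
  have d1 := h2d x' i; have d2 := h1d w0 i.
  have d3 := @cycle_type_density R B M _ _ w0 w i n00 b0 M0
    (etrans w0t (esym wt)).
  move: d1 d2 d3; rewrite /x' !ler_distl.
  do 4 move: (cycle_density _ _ _).
  move: (m%:R / _) (n0%:R / _) (M%:R^-1) => *; lra.
(* Conjugation is an isometric automorphism, so [h] inherits the estimates of [h2]. *)
pose h (r : sym_group R m) : sym_group R b := (h2 r ^ g)%g.
have hM : {morph h : a b / (a * b)%g}.
  by move=> r r'; rewrite /h h2M conjMg.
have mb : m%:R / b%:R <= delta.
  apply: le_trans (_ : delta / 4 <= delta); last lra.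
  by apply: le_trans bB; rewrite -mulrA ler_peMl ?divr_ge0 // ler1n (ltnW B1).
(* At [x] the genuine witness [a] replaces [h x'], so that [sup_at a] bounds the result. *)
pose s' v : sym_group R b := if v == x then a else h (s v).
have cl : `|eval s psi - eval s' psi| <= eps / 2.
  apply: (close _ _ h s s' hM) => [r r'|v].
    rewrite /h /=; apply: le_trans mb; apply: le_trans (h2i r r').
    by rewrite !conjgE hamming_mull hamming_mulr.
  rewrite /s'; case: eqP => [->|_].
    (* From [h x'] to [w] costs three quarters of [delta], from [w] to [a] the last one. *)
    rewrite x'E /h /=; apply: le_trans (hamming_triangle _ _ w _) _.
    apply: le_trans (lerD hg wa) _.
    rewrite !mulrDr; move: mB bB M4; rewrite !mulrA.
    move: (_ / b%:R) (_ / m%:R) (_ / M%:R) => *; lra.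
  by rewrite (bg_dist_eq0 _ _).2 // ltW.
(* Off [x] and [ys] both assignments are 1, because [h] is a homomorphism. *)
have : eval s' psi <= sup_at a.
  apply: eval_sup_le => v nv; rewrite /s' /update; case: eqP => // vx.
  rewrite s_out // /update; case: eqP => // _.
  by apply: (@mulgI _ (h 1%g)); rewrite -hM !mulg1.
move: cl ltS; rewrite ler_distl -/(sup_at x').
move: (eval s psi) (eval s' psi) (sup_at x') (sup_at a) ac => e1 e2 e3 e4.
by move=> *; lra.
Qed.

End Transport.

Theorem theorem5p6 (R : realType) (x : nat) (ys : seq nat) (psi : formula R)
    (xys_uniq : uniq (x :: ys))
    (psi_qf : quantifier_free psi)
    (psi_vars : free_vars_in (x :: ys) psi) :
  cvg ((fun n : nat =>
          value (sym_group R n) (Inf x (foldr (@Sup R) psi ys))) @ \oo).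
Proof.
apply: bounded_cvg_of_frequently => [n|c eps eps0].
  exact: eval_itv.
by apply: eventually_value_le => //; case/andP: xys_uniq.
Qed.
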